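(* For all integers $1\le r\le n$, each of the polynomials $A_{n,r}(t)$, $J_{n,r}(t)$ and $\overline{Q}_n(t)$ has only real, distinct, and nonpositive roots.
   Context: For a sequence $\pi=\pi_1\cdots\pi_s$ of positive integers and $r\ge1$, let $\operatorname{exc}_r(\pi)=|\{i\in\{1,\dots,s\}:\pi_i\ge i+r\}|$ and $\operatorname{exc}(\pi)=\operatorname{exc}_1(\pi)$. Let $A_{n,r}(t)=\sum_{\pi\in S_n}t^{\operatorname{exc}_r(\pi)}$, where $S_n$ is the set of permutations of $\{1,\dots,n\}$ written in one-line notation. Let $J_{n,r}(t)=\sum_{\pi}t^{\operatorname{exc}(\pi)}$, summing over all injections $\pi:\{1,\dots,n-r\}\to\{1,\dots,n\}$, identified with the sequences $\pi_1\cdots\pi_{n-r}$ of their values. Let $\overline{Q}_n(t)=\sum_{\pi}t^{\operatorname{des}(\pi)}$, summing over all quasi-Stirling permutations of size $n$: permutations $\pi_1\cdots\pi_{2n}$ of the multiset $\{1,1,\dots,n,n\}$ with no indices $i<j<k<\ell$ with $\pi_i=\pi_k$ and $\pi_j=\pi_\ell$; here $i\in\{1,\dots,2n\}$ is a descent if $\pi_i>\pi_{i+1}$ or $i=2n$, and $\operatorname{des}$ counts descents. *)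

(* Defs.v *)
From HB Require Import structures.
From mathcomp Require Import all_boot all_order all_algebra all_fingroup all_field.
Set Implicit Arguments. Unset Strict Implicit. Unset Printing Implicit Defensive.
Import Order.TTheory GRing.Theory Num.Theory.

(* Conventions: positions and values are 0-indexed ordinals; the 1-indexed
   sequence of the paper is pi_(i+1) = (f i) + 1. *)

Definition excr (n r : nat) (s : 'S_n) : nat :=
  #|[set i : 'I_n | (i + r <= s i)%N]|.

Definition exc_inj (m n : nat) (f : {ffun 'I_m -> 'I_n}) : nat :=
  #|[set i : 'I_m | (i.+1 <= f i)%N]|.

Definition quasiStirling (n : nat) (f : {ffun 'I_(2 * n) -> 'I_n}) : bool :=
  [forall v : 'I_n, #|[set i | f i == v]| == 2%N] &&
  ~~ [exists i : 'I_(2 * n), exists j : 'I_(2 * n), exists k : 'I_(2 * n),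
       exists l : 'I_(2 * n),
       [&& (i < j)%N, (j < k)%N, (k < l)%N, f i == f k & f j == f l]].

Definition is_descent (n : nat) (f : {ffun 'I_(2 * n) -> 'I_n}) (i : 'I_(2 * n)) : bool :=
  (i.+1 == 2 * n)%N ||
  [exists j : 'I_(2 * n), (val j == i.+1) && (f j < f i)%N].

Definition des (n : nat) (f : {ffun 'I_(2 * n) -> 'I_n}) : nat :=
  #|[set i | is_descent f i]|.

Local Open Scope ring_scope.

Definition Apoly (R : nzRingType) (n r : nat) : {poly R} :=
  \sum_(s : 'S_n) 'X^(excr r s).

Definition Jpoly (R : nzRingType) (n r : nat) : {poly R} :=
  \sum_(f : {ffun 'I_(n - r) -> 'I_n} | injectiveb f) 'X^(exc_inj f).

Definition Qbarpoly (R : nzRingType) (n : nat) : {poly R} :=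
  \sum_(f : {ffun 'I_(2 * n) -> 'I_n} | quasiStirling f) 'X^(des f).

Definition real_distinct_nonpos_roots (p : {poly algC}) : Prop :=
  exists s : seq algC,
    [/\ uniq s, all (fun x => x \is Num.real) s, all (fun x => x <= 0) s
      & p = lead_coef p *: \prod_(x <- s) ('X - x%:P)].

(* Main.v *)
Require Import Defs.
From HB Require Import structures.
From mathcomp Require Import all_boot all_order all_algebra all_fingroup all_field.
From mathcomp Require Import polyrcf zify ring.
Set Implicit Arguments. Unset Strict Implicit. Unset Printing Implicit Defensive.
Import Order.TTheory GRing.Theory Num.Theory.
Local Open Scope ring_scope.

(** Up to a nonzero constant and, for [Qbar], a factor [t], all three polynomials belong
    to a family [p_0 = 1], [p_{m+1} = (a + (b+m) t) p_m + t (1-t) p_m'] with [a, b > 0].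
    At the roots of [p_m], which are negative, [p_{m+1}] has the sign opposite to [p_m'];
    together with the signs at [0] and at minus infinity this gives [m+1] sign changes.

    For [A_{n,r}] and [J_{n,r}], rotating or reversing a permutation [s] turns the
    statistic into the number of [j >= r] with [s j < j], or its complement, and the
    recurrence comes from inserting the maximum into a cycle.

    A quasi-Stirling permutation is a plane tree with [n] labelled edges.  Its descents
    are the sum over the vertices of the cyclic descents of the labels around the vertex,
    and averaging over the labels makes the vertices independent.  Hence the exponential
    generating function satisfies [Q = A(t, zQ)], and Lagrange inversion gives
    [(n+1) Qbar_n = n! [z^n] A(t,z)^(n+1)], which satisfies the recurrence above after
    division by [t]. *)

(** * Real roots *)

(* The common recurrence of the three families: [eulp r 1 m] is the normalized
   [A_{m+r,r}], [eulp 1 r m] the normalized [J_{m+r,r}]. *)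
Fixpoint eulp (R : comNzRingType) (a b m : nat) : {poly R} :=
  if m is m'.+1 then
    ((a%:R)%:P + (b + m')%:R *: 'X) * eulp R a b m'
      + 'X * (1 - 'X) * (eulp R a b m')^`()
  else 1.

Lemma map_eulp (R S : comNzRingType) (h : {rmorphism R -> S}) a b m :
  map_poly h (eulp R a b m) = eulp S a b m.
Proof.
elim: m => [|m IH] /=; first by rewrite rmorph1.
rewrite rmorphD !rmorphM /= -deriv_map IH rmorphB rmorph1 map_polyX rmorphD /=.
by rewrite map_polyC map_polyZ map_polyX /= !rmorph_nat.
Qed.

Lemma eulp_at0 (R : comNzRingType) a b m : (eulp R a b m).[0] = a%:R ^+ m.
Proof.
elim: m => [|m IH] /=; first by rewrite hornerE expr0.
by rewrite !hornerE /= IH exprS ?(mul0r, mulr0, addr0).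
Qed.

Lemma size_eulp_le (R : comNzRingType) a b m : (size (eulp R a b m) <= m.+1)%N.
Proof.
elim: m => [|m IH] /=; first by rewrite size_poly1.
apply/leq_sizeP => -[|i] // lti; set p := eulp R a b m in IH *.
have c0 j : (m < j)%N -> p`_j = 0 by move/leq_sizeP: IH; apply.
rewrite mulrDl mulrBr mulr1 mulrBl -mulrA.
rewrite coefD coefB coefD coefCM -scalerAl coefZ !coefXM /= !coef_deriv.
by case: i lti => [|i] // lti; rewrite /= ?coef_deriv !c0 ?mul0rn; lia || ring.
Qed.

(** In degree [m + 1] the linear factor contributes [b + m] and the term [- X^2 p'] contributes
    [- m], so each step multiplies the top coefficient by [b]. *)
Lemma coef_eulp_top (R : comNzRingType) a b m : (eulp R a b m)`_m = b%:R ^+ m.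
Proof.
elim: m => [|m IH] /=; first by rewrite coef1 expr0.
have := size_eulp_le R a b m; set p := eulp R a b m in IH * => szp.
have c0 j : (m < j)%N -> p`_j = 0 by move/leq_sizeP: szp; apply.
rewrite mulrDl mulrBr mulr1 mulrBl -mulrA.
rewrite coefD coefB coefD coefCM -scalerAl coefZ !coefXM /= !coef_deriv.
rewrite c0 // IH mul0rn exprS natrD.
have -> : (if m == 0%N then 0 else p`_m.-1.+1 *+ m.-1.+1) = b%:R ^+ m * m%:R :> R.
  by rewrite -IH; case: (m) => [|k] /=; rewrite ?mulr0 // mulr_natr.
ring.
Qed.

Lemma size_eulp (R : numDomainType) a b m :
  (0 < b)%N -> size (eulp R a b m) = m.+1.
Proof.
move=> b0; apply/eqP; rewrite eqn_leq size_eulp_le /=.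
rewrite leqNgt; apply/negP => /leq_sizeP /(_ m (leqnn _)) /eqP.
by rewrite coef_eulp_top expf_eq0 pnatr_eq0; case: b b0 => // b; rewrite andbF.
Qed.

Lemma lead_coef_eulp (R : numDomainType) a b m :
  (0 < b)%N -> lead_coef (eulp R a b m) = b%:R ^+ m.
Proof. by move=> b0; rewrite lead_coefE size_eulp // coef_eulp_top. Qed.

Section RealRoots.
Variable R : rcfType.
Implicit Types (p q : {poly R}) (s : seq R).

(** Intermediate value theorem between neighbouring points. The exponent counts the points to the
    right of [x]: [q] is positive at the last point and its sign alternates leftwards. *)
Lemma alternating_roots q y s :
  path <%R y s ->
  (forall s1 x s2, y :: s = s1 ++ x :: s2 -> 0 < (-1) ^+ size s2 * q.[x]) ->
  exists zs, [/\ size zs = size s, all (root q) zs, path <%R y zs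
    & all (fun z => z < last y s) zs].
Proof.
elim: s y => [|y' s IH] y /=; first by exists [::].
move=> /andP[ltyy' ps] alt.
have [|zs [szz rz pz lz]] := IH y' ps.
  by move=> s1 x s2 e; apply: (alt (y :: s1)); rewrite e.
have q1 := alt [::] y _ erefl; have q2 := alt [:: y] y' _ erefl.
have [|z] := @poly_ivtoo _ q y y' (ltW ltyy').
  have : 0 < ((-1) ^+ size (y' :: s) * q.[y]) * ((-1) ^+ size s * q.[y']).
    exact: mulr_gt0.
  rewrite /= exprS mulrACA -mulrA -mulrA mulN1r.
  by rewrite [(-1) ^+ _ * _]mulrA -expr2 sqrr_sign mul1r oppr_gt0.
rewrite in_itv /= => /andP[yz zy'] rtz.
exists (z :: zs); rewrite /= szz rtz rz yz lz; split=> //=.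
  by rewrite (path_le (@lt_trans _ R) zy' pz).
rewrite andbT (lt_le_trans zy') //; elim: (s) y' ps {IH alt ltyy' pz q1 q2 zy' lz}
  => //= u v IH w /andP[/ltW wu /IH]; exact: le_trans.
Qed.

(** The derivative at the root [x] is [c] times the product of [x - z] over the other roots [z], and
    each of the [size s2] roots to the right gives a negative factor. *)
Lemma deriv_root_sign c s1 x s2 : 0 < c -> path.sorted <%R (s1 ++ x :: s2) ->
  0 < (-1) ^+ size s2 * (c *: \prod_(z <- s1 ++ x :: s2) ('X - z%:P))^`().[x].
Proof.
move=> c0 srt.
have [lt1 lt2] : all (fun z => z < x) s1 /\ all (fun z => x < z) s2.
  move: srt; rewrite (sorted_pairwise (@lt_trans _ R)) pairwise_cat /= allrel_consr.
  by case/and3P => /andP[-> _] _ /andP[-> _].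
rewrite big_cat big_cons /= mulrCA derivZ derivM derivXsubC mul1r.
rewrite hornerZ hornerD !hornerM hornerXsubC subrr mul0r addr0.
rewrite mulrCA mulr_gt0 // mulrCA mulr_gt0 //.
  rewrite horner_prod big_seq prodr_gt0 // => z zs.
  by rewrite hornerXsubC subr_gt0 (allP lt1).
elim: s2 lt2 {srt} => [|z s2 IH] /=; first by rewrite big_nil expr0 mul1r hornerC.
move=> /andP[xz /IH]; rewrite big_cons hornerM hornerXsubC exprS mulrACA.
by move=> h; rewrite mulr_gt0 // mulN1r opprB subr_gt0.
Qed.

Lemma eulp_roots a b m : (0 < a)%N -> (0 < b)%N ->
  exists s, [/\ path.sorted <%R s, all (fun x => x < 0) s
    & eulp R a b m = (b%:R ^+ m) *: \prod_(x <- s) ('X - x%:P)].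
Proof.
move=> a0 b0; elim: m => [|m [s [srt neg e]]].
  by exists [::]; rewrite /= big_nil expr0 scale1r.
have szs : size s = m.
  have := size_eulp R a m b0.
  by rewrite e size_scale ?expf_neq0 ?pnatr_eq0 -?lt0n // size_prod_XsubC => -[].
set q := eulp R a b m.+1.
have szq : size q = m.+2 by rewrite size_eulp.
have q0 : q != 0 by rewrite -size_poly_eq0 szq.
(* [B] stands for minus infinity: it is left of the Cauchy bound, where [q] has the sign of its
   leading term, and left of every root in [s]. *)
pose B := - cauchy_bound q - \sum_(x <- s) `|x|.
have Bq : B <= - cauchy_bound q by rewrite gerBl sumr_ge0.
have Bs x : x \in s -> B < x.
  move=> xs; have : - \sum_(x <- s) `|x| <= x.
    rewrite (big_rem x) //= lerNl.
    by rewrite (le_trans (ler_norm (- x))) // normrN lerDl sumr_ge0.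
  apply: lt_le_trans; rewrite /B gtrDr oppr_lt0; exact: cauchy_bound_gt0.
have B0 : B < 0.
  by apply: le_lt_trans Bq _; rewrite oppr_lt0 cauchy_bound_gt0.
have pth : path <%R B (s ++ [:: 0]).
  rewrite cat_path /= andbT; apply/andP; split.
    by rewrite path_min_sorted //; apply/allP => x /Bs.
  by have := mem_last B s; rewrite inE => /orP[/eqP->//|/(allP neg)].
have [|zs [szz rz pz lz]] := @alternating_roots q B (s ++ [:: 0]) pth.
  move=> [|u s1] x s2 /=; case=> eB eS.
    rewrite -eB -eS size_cat szs /= addn1.
    rewrite -sgr_cp0 sgrM (sgp_minftyP (le_cauchy_bound q0)); last first.
      by rewrite in_itv.
    rewrite /sgp_minfty szq /= lead_coef_eulp // !sgrM !sgrX.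
    rewrite [Num.sg (b%:R)]gtr0_sg ?ltr0n // expr1n mulr1 sgrN1.
    by rewrite -expr2 sqrr_sign.
  (* The sample points are [B], the roots in [s], and [0]. With [B] settled, an empty [s2] means
     [x = 0]; otherwise [x] is a root in [s]. *)
  case/lastP: s2 eS => [|s2 y] eS.
    have [_ ->] : s1 = s /\ x = 0.
      have : rcons s 0 = rcons s1 x by rewrite -!cats1.
      by case/rcons_inj.
    by rewrite expr0 mul1r eulp_at0 exprn_gt0 // ltr0n.
  have [es ey] : s = s1 ++ x :: s2 /\ 0 = y.
    have : rcons s 0 = rcons (s1 ++ x :: s2) y by rewrite -cats1 eS rcons_cat.
    by case/rcons_inj.
  have x0 : x < 0 by apply: (allP neg); rewrite es mem_cat inE eqxx orbT.
  have rx : (eulp R a b m).[x] = 0.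
    apply/rootP; rewrite e rootZ ?expf_neq0 ?pnatr_eq0 -?lt0n //.
    by rewrite root_prod_XsubC es mem_cat inE eqxx orbT.
  have bm : 0 < (b%:R ^+ m : R) by rewrite exprn_gt0 // ltr0n.
  have := deriv_root_sign bm (eq_ind _ (path.sorted <%R) srt _ es).
  rewrite -es -e size_rcons /= hornerD !hornerM rx mulr0 add0r.
  rewrite hornerD hornerN hornerX hornerC exprS => h.
  (* Only [x (1 - x) p'] survives at a root [x] of [p = eulp R a b m]. The sign of [x < 0] cancels
     against that of the additional point [0] to the right of [x]. *)
  have -> : -1 * (-1) ^+ size s2 * (x * (1 - x) * (eulp R a b m)^`().[x])
      = (- x) * (1 - x) * ((-1) ^+ size s2 * (eulp R a b m)^`().[x]) by ring.
  by rewrite mulr_gt0 // mulr_gt0 ?oppr_gt0 // subr_gt0 (lt_trans x0).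
exists zs; rewrite (path_sorted pz); split=> //.
  by move: lz; rewrite last_cat.
rewrite -[X in X *: _](lead_coef_eulp R a m.+1 b0); apply: all_roots_prod_XsubC => //.
  by rewrite szz size_cat szs addn1.
by rewrite uniq_rootsE (sorted_uniq (@lt_trans _ R) (@ltxx _ R)) // (path_sorted pz).
Qed.

End RealRoots.

(** The roots are found in the real closed field [algR] and carried to [algC], the recurrence having
    natural coefficients. As [k <= 1], the factor ['X^k] adds the root [0] at most once, and the
    others are negative. *)
Lemma eulp_real_roots a b m (c : algC) k : (0 < a)%N -> (0 < b)%N ->
  c != 0 -> (k <= 1)%N ->
  real_distinct_nonpos_roots (c *: ('X^k * eulp algC a b m)).
Proof.
move=> a0 b0 c0 k1; have [s [srt neg e]] := eulp_roots algR m a0 b0.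
pose s' := nseq k 0 ++ map algRval s.
have neg' : all (fun x => x < 0) (map algRval s) by rewrite all_map.
have eE : eulp algC a b m = (b%:R ^+ m) *: \prod_(x <- map algRval s) ('X - x%:P).
  rewrite -(map_eulp algRval) e map_polyZ rmorphXn /= rmorph_nat rmorph_prod /=.
  by rewrite big_map; congr (_ *: _); apply: eq_bigr => x _; rewrite map_polyXsubC.
have eP : c *: ('X^k * eulp algC a b m)
    = (c * b%:R ^+ m) *: \prod_(x <- s') ('X - x%:P).
  rewrite eE big_cat /= -scalerAr scalerA; congr (_ *: (_ * _)).
  by case: k k1 {s'} => [|[]] //= _; rewrite ?big_nil // big_seq1 subr0.
have nz : c * b%:R ^+ m != 0 by rewrite mulf_neq0 // expf_neq0 // pnatr_eq0 -lt0n.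
exists s'; split.
- have us : uniq (map algRval s).
    by rewrite (map_inj_uniq val_inj) (sorted_uniq (@lt_trans _ _) (@ltxx _ _)).
  rewrite cat_uniq us andbT.
  have -> : uniq (nseq k (0 : algC)) by case: k k1 {s' eP} => [|[]].
  apply/hasPn => x /(allP neg') x0; rewrite mem_nseq negb_and.
  by rewrite (lt_eqF x0) orbT.
- rewrite all_cat; apply/andP; split; first by rewrite all_nseq real0 orbT.
  by apply/allP => x /mapP[y _ ->]; exact: algRvalP.
- rewrite all_cat; apply/andP; split; first by rewrite all_nseq lexx orbT.
  by apply/allP => x /(allP neg') /ltW.
- by rewrite eP lead_coefZ (monicP (monic_prod_XsubC _ _ _)) mulr1.
Qed.

(** * Permutations and injections *)

Definition drops (n r : nat) (u : 'S_n) : nat :=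
  \sum_(j < n) ((r <= j) && (u j < j))%N.

Lemma drops_le n r (u : 'S_n) : (drops r u <= n - r)%N.
Proof.
have -> : (n - r = \sum_(j < n) (r <= j))%N.
  elim: n {u} => [|n IH]; first by rewrite big_ord0.
  by rewrite big_ord_recr /= -IH; case: leqP; lia.
by apply: leq_sum => j _; case: (r <= j)%N => //=; case: (_ < _)%N.
Qed.

Lemma widen_lift n (j : 'I_n) : widen_ord (leqnSn n) j = lift ord_max j.
Proof. exact/val_inj/esym/lift_max. Qed.

(** For [i = ord_max] the new maximum is a fixed point; for [i = lift ord_max k] it is inserted into
    a cycle between [k] and [u k]. *)
Definition insert_max n (iu : 'I_n.+1 * 'S_n) : 'S_n.+1 :=
  (tperm iu.1 ord_max * lift_perm ord_max ord_max iu.2)%g.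

Lemma insert_max_bij n : bijective (@insert_max n).
Proof.
apply: inj_card_bij; last first.
  by rewrite card_prod card_ord !card_Sn factS.
move=> [i u] [i' u'] /= e.
have ei : i = i'.
  apply: (@perm_inj _ (insert_max (i, u))); rewrite {2}e.
  by rewrite /insert_max !permM /= !tpermL !lift_perm_id.
rewrite -ei in e *; congr (_, _); apply/permP => k.
have : insert_max (i, u) (tperm i ord_max (lift ord_max k))
     = insert_max (i, u') (tperm i ord_max (lift ord_max k)) by rewrite e.
by rewrite /insert_max !permM /= !tpermK !lift_perm_lift => /lift_inj.
Qed.

Lemma drops_insert_max n r (u : 'S_n) : (r <= n)%N ->
  drops r (insert_max (ord_max, u)) = drops r u.
Proof.
move=> rn; rewrite /drops big_ord_recr /= /insert_max permM /= tpermL lift_perm_id.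
rewrite ltnn andbF addn0; apply: eq_bigr => j _.
rewrite widen_lift permM tpermD ?neq_lift //= 1?eq_sym ?neq_lift //.
by rewrite lift_perm_lift !lift_max.
Qed.

(** Position [k] is now sent to the maximum, hence is not a drop; the maximum is sent to [u k],
    which is a new drop because [r <= n]. *)
Lemma drops_insert_lift n r (u : 'S_n) k : (r <= n)%N ->
  drops r (insert_max (lift ord_max k, u))
    = (drops r u + ~~ ((r <= k) && (u k < k)))%N.
Proof.
move=> rn; rewrite /drops big_ord_recr /= /insert_max permM /= tpermR.
rewrite lift_perm_lift lift_max ltn_ord rn /= (bigD1 k) //= [in RHS](bigD1 k) //=.
rewrite widen_lift permM tpermL lift_perm_id /= [(n < k)%N]ltnNge.
rewrite (ltnW (ltn_ord k)) /= andbF.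
rewrite add0n addnAC addnC; congr (_ + _)%N; first by case: (_ && _).
apply: eq_bigr => j jk; rewrite widen_lift permM tpermD; last exact: neq_lift.
  by rewrite lift_perm_lift !lift_max.
by rewrite (inj_eq lift_inj) eq_sym.
Qed.

(** Of the [n + 1] insertions, the fixed point and those right after a drop preserve the number of
    drops; the others raise it by one. A general [G] covers both the drops and their complement. *)
Lemma sum_drops_rec (V : zmodType) n r (G : nat -> V) : (r <= n)%N ->
  \sum_(s : 'S_n.+1) G (drops r s)
    = \sum_(u : 'S_n) (G (drops r u) *+ (drops r u).+1
                       + G (drops r u).+1 *+ (n - drops r u)).
Proof.
move=> rn; rewrite (reindex _ (onW_bij _ (@insert_max_bij n))) /=.
rewrite (eq_bigr (fun p => G (drops r (insert_max (p.1, p.2))))); last by case.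
rewrite -(pair_bigA _ (fun i u => G (drops r (insert_max (i, u))))) exchange_big /=.
apply: eq_bigr => u _; rewrite big_ord_recr /= drops_insert_max // addrC mulrS -addrA.
congr (_ + _).
rewrite (eq_bigr (fun k : 'I_n => G (drops r u) *+ ((r <= k) && (u k < k))%N
   + G (drops r u).+1 *+ ~~ ((r <= k) && (u k < k))%N)).
  rewrite big_split /= !sumrMnr; congr (_ *+ _ + _ *+ _).
  transitivity (\sum_(k < n) 1 - drops r u)%N; last by rewrite sum1_card card_ord.
  rewrite /drops -sumnB; last by move=> k _; case: (_ && _).
  by apply: eq_bigr => k _; case: (_ && _).
move=> k _; rewrite widen_lift drops_insert_lift //.
by case: (_ && _); rewrite ?addn0 ?addn1 ?mulr0n ?mulr1n ?addr0 ?add0r.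
Qed.

Lemma drops_eq0 n (u : 'S_n) : drops n u = 0%N.
Proof. by rewrite /drops big1 // => j _; rewrite leqNgt ltn_ord. Qed.

(** The recurrence sends ['X^d] to [(d+1) X^d + (r+m-d) X^(d+1)], which matches the count of
    insertions. For [m = 0] no drop is possible, whence the constant [r!]. *)
Lemma sum_drops (R : comNzRingType) r m :
  \sum_(u : 'S_(r + m)) 'X^(drops r u) = (r`!)%:R *: eulp R 1 r m.
Proof.
elim: m => [|m IH].
  rewrite addn0 /= (eq_bigr (fun=> 1)); last by move=> u _; rewrite drops_eq0 expr0.
  by rewrite sumr_const card_Sn scaler_nat.
rewrite addnS sum_drops_rec ?leq_addr //= scalerDr !scalerAr -derivZ -IH.
rewrite linear_sum !mulr_sumr -big_split /=; apply: eq_bigr => u _.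
have := drops_le r u; move: (drops r u) => d dle.
rewrite derivXn -!(mulr_natr ('X^_)) natrB; last by lia.
rewrite -mul_polyC !polyC_natr.
case: d dle => [|d] _; rewrite ?expr0 ?exprS ?mulr0n ?mulr0 /=; ring.
Qed.

Lemma sum_codrops (R : comNzRingType) r m :
  \sum_(u : 'S_(r + m)) 'X^(m - drops r u) = (r`!)%:R *: eulp R r 1 m.
Proof.
elim: m => [|m IH].
  rewrite addn0 /= (eq_bigr (fun=> 1)); last by move=> u _; rewrite drops_eq0 expr0.
  by rewrite sumr_const card_Sn scaler_nat.
rewrite addnS (sum_drops_rec (fun d => 'X^(m.+1 - d))) ?leq_addr //=.
rewrite scalerDr !scalerAr -derivZ -IH.
rewrite linear_sum !mulr_sumr -big_split /=; apply: eq_bigr => u _.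
have := drops_le r u; rewrite addKn; move: (drops r u) => d dle.
have [k ->] : exists k, m = (d + k)%N by exists (m - d)%N; lia.
rewrite subSS addKn -addnS addKn addnCA addKn.
rewrite derivXn -!(mulr_natr ('X^_)) -mul_polyC !polyC_natr.
case: k => [|k]; rewrite ?expr0 ?exprS ?mulr0n ?mulr0 /=; ring.
Qed.

(** Rotating the positions by [r] turns [i + r <= s i] into [j <= u j] at [j = i + r]; this counts
    the positions [j >= r] that are not drops. *)
Lemma Apoly_eulp (R : comNzRingType) r m :
  Apoly R (r + m) r = (r`!)%:R *: eulp R r 1 m.
Proof.
rewrite -sum_codrops /Apoly.
have [z|n0] := posnP (r + m).
  apply: congr_big => // s _; congr ('X^ _).
  rewrite (_ : m - drops r s = 0)%N; last by lia.
  by apply/eqP; rewrite cards_eq0; apply/eqP/setP => i; have := ltn_ord i; lia.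
pose c0 (i : 'I_(r + m)) := Ordinal (ltn_pmod (i + r) n0).
have c0I : injective c0.
  move=> i j /(congr1 val) /= /eqP; rewrite eqn_modDr !modn_small // => /eqP.
  exact: val_inj.
pose c := perm c0I.
rewrite (reindex_inj (mulgI c)); apply: eq_bigr => u _; congr ('X^ _).
have -> : excr r (c * u)%g = (\sum_(j < r + m) ((r <= j) && (j <= u j))%N)%N.
  rewrite /excr -sum1_card [RHS](reindex_inj (@perm_inj _ c)) big_mkcond /=.
  apply: eq_bigr => i _; rewrite inE permM permE /=.
  have [ltn|gen] := ltnP (i + r) (r + m).
    by rewrite modn_small // leq_addl /=; case: (_ <= _)%N.
  (* A position that wraps around lands below [r], and [i + r] exceeds every value, so it counts on
     neither side. *)
  have -> : ((i + r) %% (r + m) = i - m)%N.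
    have {1}-> : (i + r = (r + m) + (i - m))%N by have := ltn_ord i; lia.
    by rewrite modnDl modn_small //; have := ltn_ord i; lia.
  have := ltn_ord (u (c0 i)); have := ltn_ord i.
  move: (nat_of_ord (u _)) => x h1 h2; rewrite [(i + r <= x)%N]leqNgt.
  by rewrite [(r <= i - m)%N]leqNgt (leq_trans h2 gen) (_ : i - m < r)%N //; lia.
have sm : (\sum_(j < r + m) (r <= j) = m)%N.
  elim: (m) => [|k IH]; first by rewrite addn0 big1 // => j _; rewrite leqNgt ltn_ord.
  rewrite addnS big_ord_recr /= IH; lia.
transitivity (\sum_(j < r + m) (r <= j) - drops r u)%N; last by rewrite sm.
rewrite /drops -sumnB; last by move=> j _; case: (r <= j)%N => //=; case: ltnP.
by apply: eq_bigr => j _; case: (r <= j)%N => //=; case: ltnP.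
Qed.

Section Restriction.
Variables (m n : nat) (le_mn : (m <= n)%N).

Definition restr (s : 'S_n) : {ffun 'I_m -> 'I_n} :=
  [ffun i => s (widen_ord le_mn i)].

Lemma restr_inj s : injectiveb (restr s).
Proof.
by apply/injectiveP => i j; rewrite !ffunE => /perm_inj /(congr1 val) /= /val_inj.
Qed.

Lemma restr_ext (f : {ffun 'I_m -> 'I_n}) : injectiveb f -> exists s, restr s = f.
Proof.
move=> /injectiveP fI.
(* The values of [f] followed by the missed ones: [L] lists ['I_n] without repetition, so the
   default of [nth] below is never reached. *)
pose L := codom f ++ [seq x <- enum 'I_n | x \notin codom f].
have uL : uniq L.
  rewrite cat_uniq filter_uniq ?enum_uniq // andbT map_inj_uniq // enum_uniq /=.
  by apply/hasPn => x; rewrite mem_filter => /andP[].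
have szL : size L = n.
  rewrite -(card_uniqP uL) -[RHS]card_ord; apply: eq_card => x.
  by rewrite mem_cat mem_filter mem_enum !inE andbT orbN.
pose g (i : 'I_n) := nth i L i.
have gI : injective g.
  move=> i j /eqP; rewrite /g (set_nth_default j) ?szL //.
  by rewrite nth_uniq ?szL // => /eqP /val_inj.
exists (perm gI); apply/ffunP => i; rewrite ffunE permE /g nth_cat size_codom card_ord.
rewrite /= ltn_ord /codom /image_mem (nth_map i) ?size_enum_ord //.
by congr (f _); apply: val_inj; rewrite /= nth_enum_ord.
Qed.

(** All fibres of the restriction have the same size [K]: composition with [s0] carries the fibre of
    the identity onto that of [s0]. *)
Lemma sum_restr (V : zmodType) (F : {ffun 'I_m -> 'I_n} -> V) :
  exists2 K : nat, (0 < K)%N &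
  \sum_(s : 'S_n) F (restr s) = (\sum_(f : {ffun 'I_m -> 'I_n} | injectiveb f) F f) *+ K.
Proof.
exists #|[set v : 'S_n | restr v == restr 1%g]|.
  by apply/card_gt0P; exists 1%g; rewrite inE.
rewrite (partition_big restr (fun f => injectiveb f)) /=; last first.
  by move=> s _; exact: restr_inj.
rewrite -sumrMnl; apply: eq_bigr => f /restr_ext[s0 <-].
rewrite (eq_bigr (fun=> F (restr s0))); last by move=> s /eqP->.
rewrite (reindex_inj (mulIg s0)) sumr_const; congr (_ *+ _); apply: eq_card => v.
rewrite inE; transitivity (restr (v * s0)%g == restr s0) => //.
apply/eqP/eqP => e; apply/ffunP => i.
  by have := congr1 (fun g => fun_of_fin g i) e; rewrite !ffunE permM perm1 => /perm_inj.
by have := congr1 (fun g => fun_of_fin g i) e; rewrite !ffunE permM perm1 => ->.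
Qed.

End Restriction.

(** Conjugating a permutation by the reversal [i -> r + m - 1 - i] turns an excedance among the
    first [m] positions into a drop at a position [j >= r]. *)
Lemma Jpoly_eulp (R : comNzRingType) r m : exists2 K : nat, (0 < K)%N &
  Jpoly R (r + m) r *+ K = (r`!)%:R *: eulp R 1 r m.
Proof.
have le : (r + m - r <= r + m)%N by exact: leq_subr.
have [K K0 e] := sum_restr le (fun f => 'X^(exc_inj f) : {poly R}).
exists K => //; rewrite -e -sum_drops.
pose rv := perm (@rev_ord_inj (r + m)).
rewrite (reindex_inj (mulgI rv)) (reindex_inj (mulIg rv)).
apply: eq_bigr => u _; congr ('X^ _).
rewrite /exc_inj -sum1_card /drops.
rewrite [RHS](reindex_inj rev_ord_inj) /=.
rewrite (bigID (fun i : 'I_(r + m) => (i < r + m - r)%N)) /= [X in _ = (_ + X)%N]big1 ?addn0.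
  rewrite (big_ord_narrow le) /= big_mkcond; apply: eq_bigr => i _.
  rewrite inE ffunE !permM !permE.
  have -> : (r <= r + m - i.+1)%N by have := ltn_ord i; lia.
  set j := rev_ord _.
  have := ltn_ord i; have := ltn_ord (u j); rewrite /= => h1 h2.
  by case: ltnP => h3; case: ltnP => h4 //=; lia.
by move=> i h; case: leqP => //=; have := ltn_ord i; lia.
Qed.

(** * Powers of the Eulerian generating function *)

Section BinomialConvolution.
Variable R : comNzRingType.
Implicit Types a b : nat -> R.

(** The coefficients of a product of exponential generating functions. *)
Definition bconv a b m : R := \sum_(j < m.+1) a j * b (m - j)%N *+ 'C(m, j).

(** Leibniz rule, since a shift of the sequence differentiates its exponential generating function;
    on coefficients it is Pascal's rule. *)
Lemma bconvS a b m :
  bconv a b m.+1 = bconv (fun j => a j.+1) b m + bconv a (fun j => b j.+1) m.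
Proof.
rewrite /bconv big_ord_recl /= bin0 mulr1n subn0.
under eq_bigr => i _ do rewrite /bump /= add1n subSS binS mulrnDr.
rewrite big_split /= addrA addrC; congr (_ + _).
rewrite big_ord_recr /= bin_small // mulr0n addr0 [RHS]big_ord_recl /= bin0 mulr1n subn0.
congr (_ + _); apply: eq_bigr => i _; rewrite /bump /= add1n.
by congr (_ * b _ *+ _); have := ltn_ord i; lia.
Qed.

End BinomialConvolution.

Section Eulerian.
Variable R : comNzRingType.

Lemma deriv_poly1 : (1 : {poly R})^`() = 0.
Proof. by rewrite -polyC1 derivC. Qed.

(** The step of [eulp] for the parameters [a = 0] and [b = k]. *)
Definition estep k j (p : {poly R}) : {poly R} :=
  (j + k)%:R * 'X * p + 'X * (1 - 'X) * p^`().

(* [epoly k m] is [m! [z^m] A(t,z)^k], where [A(t,z)] is the exponential generating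
   function of the Eulerian polynomials. *)
Fixpoint epoly k m : {poly R} := if m is m'.+1 then estep k m' (epoly k m') else 1.

(** [X (1 - X) d/dX] is a derivation, and the remaining coefficients add up:
    [(j + k) + (m - j + l) = m + (k + l)]. *)
Lemma bconv_estep k l (a b : nat -> {poly R}) m :
  (forall j, a j.+1 = estep k j (a j)) -> (forall j, b j.+1 = estep l j (b j)) ->
  bconv a b m.+1 = estep (k + l) m (bconv a b m).
Proof.
move=> ha hb; rewrite bconvS /bconv /estep linear_sum !mulr_sumr -!big_split /=.
apply: eq_bigr => j _; rewrite ha hb /estep derivMn derivM.
have -> : ((m + (k + l)) = (j + k) + (m - j + l))%N by have := ltn_ord j; lia.
by rewrite [in RHS]natrD; ring.
Qed.

Lemma bconv_epoly k l m : bconv (epoly k) (epoly l) m = epoly (k + l) m.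
Proof.
elim: m => [|m IH]; last by rewrite (@bconv_estep k l) // IH.
by rewrite /bconv big_ord_recl big_ord0 /= bin0 addr0 mulr1.
Qed.

(** In generating functions, [(k + l) (A^k)' A^l = k (A^(k+l))'], with the derivative taken in
    [z]. *)
Lemma bconv_epolyS k l m :
  (k + l)%:R * bconv (fun j => epoly k j.+1) (epoly l) m = k%:R * epoly (k + l) m.+1.
Proof.
have stepZ (c : {poly R}) h j p : c^`() = 0 -> c * estep h j p = estep h j (c * p).
  by move=> c0; rewrite /estep derivM c0; ring.
have nat0 n : (n%:R : {poly R})^`() = 0 by rewrite -polyC_natr derivC.
elim: m => [|m IH].
  rewrite /bconv big_ord_recl big_ord0 /= bin0 addr0 mulr1 mulr1n /estep !add0n.
  by rewrite deriv_poly1; ring.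
(* The shifted sequence [epoly k j.+1] obeys the recurrence with [k + 1] in place of [k]. *)
rewrite (@bconv_estep k.+1 l) //; last by move=> j /=; rewrite /estep addSnnS.
rewrite stepZ // IH -stepZ //; congr (_ * _).
by rewrite [RHS]/= /estep (_ : (m + (k.+1 + l) = m.+1 + (k + l))%N) //; lia.
Qed.

(** Dividing the recurrence by [X] changes the parameter [a] from [0] to [1], which the argument on
    roots needs to be positive. *)
Lemma epoly_eulp s m : epoly s m.+1 = s%:R * 'X * eulp R 1 s m.
Proof.
elim: m => [|m IH].
  by rewrite /= /estep deriv_poly1 add0n; ring.
rewrite [epoly _ _]/= -/(epoly s m.+1) IH /estep /= !derivM derivX.
rewrite -[in _^`()](polyC_natr R s) derivC -mul_polyC -!polyC_natr.
by rewrite addSn addnC -addnS natrD -[_.+1]addn1 !natrD; ring.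
Qed.

End Eulerian.

(** * Lagrange inversion for truncated power series *)

Section LagrangeInversion.
Variable F : numFieldType.
Notation T := {poly F}.

(** The ordinary coefficient [[z^j] A(t,z)^k]. *)
Definition ehat k j : T := (j`!%:R^-1)%:P * epoly F k j.

Lemma natr_polyCV n : (0 < n)%N -> n%:R * (n%:R^-1)%:P = 1 :> T.
Proof.
move=> n0; rewrite -polyC_natr -polyCM mulfV ?polyC1 //.
by rewrite pnatr_eq0 -lt0n.
Qed.

Lemma factV_bin m j : (j <= m)%N ->
  (j`!%:R^-1)%:P * ((m - j)`!%:R^-1)%:P = (m`!%:R^-1)%:P * 'C(m, j)%:R :> T.
Proof.
move=> jm; rewrite -(bin_fact jm) -polyC_natr -!polyCM; congr (_%:P).
have f0 i : (i`!)%:R != 0 :> F by rewrite pnatr_eq0 -lt0n fact_gt0.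
rewrite !natrM; field.
by rewrite !f0 pnatr_eq0 -lt0n bin_gt0 jm.
Qed.

Lemma ehat_conv k l m : \sum_(j < m.+1) ehat k j * ehat l (m - j) = ehat (k + l) m.
Proof.
rewrite [RHS]/ehat -bconv_epoly /bconv mulr_sumr; apply: eq_bigr => j _.
have h := @factV_bin m j (ltn_ord j).
transitivity ((j`!%:R^-1)%:P * ((m - j)`!%:R^-1)%:P
   * (epoly F k j * epoly F l (m - j))); first by rewrite /ehat; ring.
by rewrite h; ring.
Qed.

Lemma ehat_convS k l m : (k + l)%:R * (\sum_(j < m.+1)
    (j.+1%:R * ehat k j.+1) * ehat l (m - j)) = k%:R * m.+1%:R * ehat (k + l) m.+1.
Proof.
have fS i (p : T) : i.+1%:R * ((i.+1)`!%:R^-1)%:P * p = (i`!%:R^-1)%:P * p.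
  by rewrite factS natrM invfM polyCM mulrA natr_polyCV // mul1r.
rewrite -mulrA [m.+1%:R * _]mulrA fS mulrCA -bconv_epolyS mulrCA; congr (_ * _).
rewrite mulr_sumr; apply: eq_bigr => j _.
have h := @factV_bin m j (ltn_ord j).
rewrite /ehat [j.+1%:R * _]mulrA fS.
transitivity ((j`!%:R^-1)%:P * ((m - j)`!%:R^-1)%:P
   * (epoly F k j.+1 * epoly F l (m - j))); first by ring.
by rewrite h; ring.
Qed.

Section Truncated.
Variable N : nat.

(** Power series in [z] over [T = F[t]] are represented by polynomials compared modulo [z^(N+1)]. *)
Definition eq_upto (p q : {poly T}) := forall i, (i <= N)%N -> p`_i = q`_i.

Lemma eq_uptoM p p' q q' : eq_upto p p' -> eq_upto q q' -> eq_upto (p * q) (p' * q').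
Proof.
move=> ep eq i iN; rewrite !coefM; apply: eq_bigr => j _.
by rewrite ep ?eq //; have := ltn_ord j; lia.
Qed.

Lemma eq_uptoX p q k : eq_upto p q -> eq_upto (p ^+ k) (q ^+ k).
Proof.
by move=> e; elim: k => [|k IH]; rewrite ?expr0 // !exprS; apply: eq_uptoM.
Qed.

Definition eser k : {poly T} := \poly_(j < N.+1) ehat k j.

Lemma eser_pow k : eq_upto (eser 1 ^+ k) (eser k).
Proof.
elim: k => [|k IH] i iN.
  rewrite expr0 coef1 coef_poly ltnS iN.
  case: i {iN} => [|i]; first by rewrite /ehat /= invr1 mulr1.
  have -> : ehat 0 i.+1 = 0; last by [].
  rewrite /ehat; suff -> : epoly F 0 i.+1 = 0 by rewrite mulr0.
  elim: i => [|i IH]; rewrite /= /estep /=; last first.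
    by rewrite -/(estep 0 i _) -/(epoly F 0 i.+1) IH deriv0 !mulr0 addr0.
  by rewrite deriv_poly1; ring.
rewrite exprSr (eq_uptoM IH (fun _ _ => erefl)) // coefM coef_poly ltnS iN.
rewrite -[k.+1]addn1 -ehat_conv; apply: eq_bigr => j _.
have ji : (j <= i)%N by rewrite -ltnS.
by rewrite !coef_poly !ltnS (leq_trans ji iN) (leq_trans (leq_subr _ _) iN).
Qed.

Variable Y : {poly T}.
Let W := 'X * Y.

Lemma coef_XY_pow j m : (W ^+ j)`_m = if (m < j)%N then 0 else (Y ^+ j)`_(m - j).
Proof. by rewrite exprMn coefXnM. Qed.

(** [W ^+ j] is divisible by [z^j], so only the indices [j <= m] reach the coefficient of [z^m]. *)
Lemma coef_comp_XY (p : {poly T}) m :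
  (p \Po W)`_m = \sum_(j < m.+1) p`_j * (W ^+ j)`_m.
Proof.
rewrite coef_comp_poly.
have big0 j : (m.+1 <= j)%N -> p`_j * (W ^+ j)`_m = 0.
  by move=> h; rewrite coef_XY_pow h mulr0.
have bigp j : (size p <= j)%N -> p`_j * (W ^+ j)`_m = 0.
  by move=> h; rewrite nth_default // mul0r.
rewrite -(big_mkord xpredT (fun j => p`_j * (W ^+ j)`_m)).
rewrite -[RHS](big_mkord xpredT (fun j => p`_j * (W ^+ j)`_m)).
case: (leqP (size p) m.+1) => h.
  rewrite [RHS](big_cat_nat (leq0n _) h) /= [X in _ + X]big_nat [X in _ + X]big1 ?addr0 //.
  by move=> i /andP[hi _]; exact: bigp.
rewrite [LHS](big_cat_nat (leq0n _) (ltnW h)) /= [X in _ + X]big_nat [X in _ + X]big1 ?addr0 //.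
by move=> i /andP[hi _]; exact: big0.
Qed.

Hypothesis eqY : eq_upto Y (eser 1 \Po W).

Lemma coef_powY k i : (i <= N)%N ->
  (Y ^+ k)`_i = \sum_(j < i.+1) ehat k j * (W ^+ j)`_i.
Proof.
move=> iN; rewrite (eq_uptoX k eqY) // -rmorphXn /= coef_comp_XY.
apply: eq_bigr => j _; have ji : (j <= N)%N by have := ltn_ord j; lia.
by rewrite eser_pow // coef_poly ltnS ji.
Qed.

(** Strong induction on [m]. Expand [Y^k = A(W)^k]: the coefficient of [z^m] in [W^j] is that of
    [z^(m-j)] in [Y^j], known by induction as [j/m [z^(m-j)] A^m]. The resulting sum is a
    coefficient of [(A^k)' A^m], which [ehat_convS] evaluates. *)
Lemma lagrange m k : (m <= N)%N -> (0 < m + k)%N ->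
  (m + k)%:R * (Y ^+ k)`_m = k%:R * ehat (m + k) m.
Proof.
have [n] := ubnP m; elim: n => // n IH in m k *; rewrite ltnS => mn mN mk.
have e0 l : ehat l 0 = 1 by rewrite /ehat /= invr1 mulr1.
case: m => [|m] in mn mN mk *.
  rewrite coef_powY // big_ord_recl big_ord0 expr0 coef1 !e0 addr0 add0n.
  by rewrite !mulr1.
rewrite coef_powY // big_ord_recl expr0 coef1 /= mulr0 add0r.
have hj (j : 'I_m.+1) : (W ^+ j.+1)`_m.+1
    = (m.+1%:R^-1)%:P * (j.+1%:R * ehat m.+1 (m - j)).
  have jm : (j <= m)%N by rewrite -ltnS.
  have h := IH (m - j)%N j.+1; rewrite (_ : (m - j + j.+1 = m.+1)%N) in h; last by lia.
  rewrite coef_XY_pow ltnNge ltnS jm /= subSS -h; try lia.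
  by rewrite mulrA [_%:P * _]mulrC natr_polyCV // mul1r.
under eq_bigr => j _ do rewrite /bump /= add1n hj.
have := ehat_convS k m.+1 m; rewrite [(k + m.+1)%N]addnC => h.
transitivity ((m.+1%:R^-1)%:P * ((m.+1 + k)%:R *
   \sum_(j < m.+1) j.+1%:R * ehat k j.+1 * ehat m.+1 (m - j))).
  by rewrite !mulr_sumr; apply: eq_bigr => j _; move: (m.+1%:R^-1)%:P => c; ring.
transitivity (m.+1%:R * (m.+1%:R^-1)%:P * (k%:R * ehat (m.+1 + k) m.+1)).
  by rewrite h; move: (m.+1%:R^-1)%:P => c; ring.
by rewrite natr_polyCV // mul1r.
Qed.

End Truncated.

(** The first four hypotheses say that [V m k] is [[z^m] (z y(z))^k]; the last is the equation
    [y = A(t, z y)]. *)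
Lemma lagrange_inversion (y : nat -> T) (V : nat -> nat -> T) n :
  V 0%N 0%N = 1 -> (forall k, V 0%N k.+1 = 0) -> (forall m, V m.+1 0%N = 0) ->
  (forall m k, V m.+1 k.+1 = \sum_(i < m.+1) y i * V (m - i)%N k) ->
  (forall m, y m = \sum_(k < m.+1) ehat 1 k * V m k) ->
  n.+1%:R * y n = ehat n.+1 n.
Proof.
move=> V00 V0S VS0 VSS yE.
pose Y : {poly T} := \poly_(i < n.+1) y i.
have VE k m : (m <= n)%N -> (('X * Y) ^+ k)`_m = V m k.
  elim: k m => [|k IH] [|m] mn; rewrite ?expr0 ?coef1 ?V00 ?VS0 //.
    by rewrite exprS -mulrA coefXM V0S.
  rewrite exprS -mulrA coefXM /= coefM VSS; apply: eq_bigr => i _.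
  rewrite coef_poly IH; last by have := ltn_ord i; lia.
  by rewrite (leq_trans (ltn_ord i)) // ltnW.
have eqY : eq_upto n Y (eser n 1 \Po ('X * Y)).
  move=> i iN; rewrite coef_comp_XY coef_poly ltnS iN yE; apply: eq_bigr => j _.
  have ji : (j <= n)%N by have := ltn_ord j; lia.
  by rewrite VE // coef_poly ltnS ji.
have := @lagrange n Y eqY n 1 (leqnn n); rewrite addn1 => /(_ isT).
by rewrite expr1 coef_poly ltnSn mul1r.
Qed.

End LagrangeInversion.

(** * Averages over permutations *)

Section PermutationSums.
Variables (T : eqType) (R : comNzRingType).
Implicit Types (M C : seq T) (f g h : seq T -> R).

Lemma sum_perms_cons M f : uniq M -> (0 < size M)%N ->
  \sum_(s <- permutations M) f s
    = \sum_(x <- M) \sum_(s <- permutations (rem x M)) f (x :: s).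
Proof.
move=> uM M0; rewrite (perm_big _ (permutationsE M0)) undup_id //=.
by rewrite big_allpairs_dep.
Qed.

Lemma perm_map_rev_permutations M :
  perm_eq (permutations M) (map rev (permutations M)).
Proof.
apply: uniq_perm => [||s]; rewrite ?map_inj_uniq ?permutations_uniq //.
  exact: (can_inj revK).
apply/idP/mapP => [|[t]]; rewrite !mem_permutations => h.
  by exists (rev s); rewrite ?revK // mem_permutations perm_rev.
by move=> ->; rewrite perm_rev.
Qed.

Lemma sum_perms_rcons M f : uniq M -> (0 < size M)%N ->
  \sum_(s <- permutations M) f s
    = \sum_(x <- M) \sum_(s <- permutations (rem x M)) f (rcons s x).
Proof.
move=> uM M0; rewrite (perm_big _ (perm_map_rev_permutations M)) /= big_map.
rewrite sum_perms_cons //; apply: eq_bigr => x _.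
rewrite (perm_big _ (perm_map_rev_permutations _)) /= big_map.
by apply: eq_bigr => s _; rewrite rev_cons revK.
Qed.

Lemma rem_mid (x : T) s1 s2 : x \notin s1 -> rem x (s1 ++ x :: s2) = s1 ++ s2.
Proof.
elim: s1 => [|y s1 IH] /=; first by rewrite eqxx.
by rewrite inE negb_or eq_sym => /andP[/negPf -> /IH ->].
Qed.

(** Each arrangement of [x :: M] arises from exactly one insertion: [index] recovers the place of
    [x] and [rem] the other letters. *)
Lemma sum_perms_insert x M f : uniq (x :: M) ->
  \sum_(s <- permutations (x :: M)) f s = \sum_(s <- permutations M)
    \sum_(i < (size s).+1) f (take i s ++ x :: drop i s).
Proof.
move=> uxM; have [xM uM] := andP uxM.
pose ins (s : seq T) i := take i s ++ x :: drop i s.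
pose L := [seq ins s i | s <- permutations M, i <- iota 0 (size s).+1].
have xs s : s \in permutations M -> x \notin s.
  by rewrite mem_permutations => /perm_mem ->.
suff e : perm_eq (permutations (x :: M)) L.
  rewrite (perm_big _ e) /= big_allpairs_dep; apply: eq_bigr => s _.
  by rewrite -(big_mkord xpredT (fun i => f (ins s i))) /index_iota subn0.
have iE s i : x \notin s -> (i <= size s)%N -> index x (ins s i) = i.
  move=> h1 h2; rewrite index_cat /= eqxx addn0 size_takel // ifN //.
  by apply: contra h1 => /mem_take.
have rE s i : x \notin s -> (i <= size s)%N -> rem x (ins s i) = s.
  move=> h1 h2; rewrite rem_mid ?cat_take_drop //.
  by apply: contra h1 => /mem_take.
apply: uniq_perm => [||s]; first exact: permutations_uniq.
  apply/allpairs_uniq_dep => [|s _|]; rewrite ?permutations_uniq ?iota_uniq //.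
  move=> _ _ /allpairsPdep[t [i [/xs h1 h2 ->]]] /allpairsPdep[u [j [/xs h3 h4 ->]]] /= e.
  have [hi hj] : (i <= size t)%N /\ (j <= size u)%N by move: h2 h4; rewrite !mem_iota; lia.
  have ij : i = j by rewrite -(iE t i) // e iE.
  by have tu : t = u; [rewrite -(rE t i) // e rE | rewrite ij tu].
rewrite mem_permutations; apply/idP/allpairsPdep => [ps | [t [i [h1 h2 ->]]]].
  have sx : x \in s by rewrite (perm_mem ps) mem_head.
  exists (rem x s), (index x s); rewrite mem_permutations mem_iota add0n leq0n /=; split.
  - by rewrite -(perm_cons x) -(permPl (perm_to_rem sx)).
  - by rewrite size_rem //; move: sx; rewrite -index_mem; lia.
  - rewrite /ins remE take_cat drop_cat size_takel ?index_size // ltnn subnn take0 cats0 drop0.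
    rewrite -{1}(cat_take_drop (index x s) s); congr (_ ++ _).
    by rewrite (drop_nth x) ?index_mem // nth_index.
rewrite mem_permutations in h1.
by rewrite /ins -cat1s perm_catCA /= perm_cons cat_take_drop.
Qed.

Lemma sum_perms_const M (c : R) : uniq M ->
  \sum_(s <- permutations M) c = c *+ (size M)`!.
Proof.
by move=> uM; rewrite big_const_seq count_predT size_permutations // iter_addr_0.
Qed.

(** The mean [H] of [h] is the same for every set of [q] letters, so the suffix can be averaged for
    each fixed prefix. *)
Lemma sum_perms_suffix M k q f h (H : R) :
  uniq M -> size M = (k + q)%N ->
  (forall C, uniq C -> {subset C <= M} -> size C = q ->
     \sum_(s <- permutations C) h s = H *+ q`!) ->
  \sum_(s <- permutations M) f (take k s) * h (drop k s)
    = H * \sum_(s <- permutations M) f (take k s).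
Proof.
elim: k M f => [|k IH] M f uM sM hH.
  under eq_bigr => s _ do rewrite take0 drop0.
  rewrite -mulr_sumr hH //; under [in RHS]eq_bigr => s _ do rewrite take0.
  by rewrite sum_perms_const // sM; ring.
have M0 : (0 < size M)%N by rewrite sM.
rewrite !sum_perms_cons // mulr_sumr big_seq [RHS]big_seq; apply: eq_bigr => x xM /=.
apply: (IH _ (fun s => f (x :: s))); rewrite ?rem_uniq ?size_rem ?sM //.
by move=> C uC sC; apply: hH => // z /sC /mem_rem.
Qed.

(** Fixing the letters after position [k] one at a time, from the end, leaves the sum over
    arrangements of a [k]-letter set. *)
Lemma sum_perms_prefix M k f g (c : R) :
  uniq M -> (k <= size M)%N ->
  (forall C, uniq C -> {subset C <= M} -> size C = k ->
     \sum_(s <- permutations C) f s = c * \sum_(s <- permutations C) g s) ->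
  \sum_(s <- permutations M) f (take k s) = c * \sum_(s <- permutations M) g (take k s).
Proof.
move=> + /subnKC; move: (size M - k)%N => q; elim: q M => [|q IH] M uM sM hc.
  rewrite addn0 in sM; have tk s : s \in permutations M -> take k s = s.
    by rewrite mem_permutations => /perm_size e; rewrite take_oversize // e sM.
  have e h : \sum_(s <- permutations M) h (take k s) = \sum_(s <- permutations M) h s.
    by apply: eq_big_seq => s hs; rewrite tk.
  by rewrite !e hc.
have M0 : (0 < size M)%N by rewrite -sM addnS.
rewrite !sum_perms_rcons // mulr_sumr big_seq [RHS]big_seq; apply: eq_bigr => x xM /=.
have szr : size (rem x M) = (k + q)%N by rewrite size_rem // -sM addnS.
have tk s : s \in permutations (rem x M) -> take k (rcons s x) = take k s.
  rewrite mem_permutations => /perm_size e.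
  by rewrite -cats1 takel_cat // e szr leq_addr.
have e h : \sum_(s <- permutations (rem x M)) h (take k (rcons s x))
    = \sum_(s <- permutations (rem x M)) h (take k s).
  by apply: eq_big_seq => s hs; rewrite tk.
rewrite !e IH ?rem_uniq //.
by move=> C uC sC; apply: hc => // z /sC /mem_rem.
Qed.

End PermutationSums.

(** The preceding letter is an argument, so that [ndes p (rcons s p)] counts the cyclic descents of
    [p :: s]. *)
Fixpoint ndes (x : nat) (s : seq nat) : nat :=
  if s is y :: s' then ((y < x) + ndes y s')%N else 0%N.

Lemma ndes_cat x s1 s2 : ndes x (s1 ++ s2) = (ndes x s1 + ndes (last x s1) s2)%N.
Proof. by elim: s1 x => //= y s1 IH x; rewrite IH addnA. Qed.

Lemma ndes_size x s : (ndes x s <= size s)%N.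
Proof. by elim: s x => //= y s IH x; have := IH y; case: (y < x)%N; lia. Qed.

Section CyclicDescents.
Variable R : comNzRingType.
Notation wt x s y := ('X^(ndes x (rcons s y)) : {poly R}).

(* The hypothesis says that [m] is larger, or smaller, than every other label. *)
Lemma sum_insert m x t y :
  (forall u v, u \in [:: x, y & t] -> v \in [:: x, y & t] -> (m < u) + (v < m) = 1)%N ->
  let d := ndes x (rcons t y) in
  \sum_(i < (size t).+1) wt x (take i t ++ m :: drop i t) y
    = 'X^d *+ d + 'X^(d.+1) *+ ((size t).+1 - d).
Proof.
elim: t x => [|z t IH] x hm /=.
  rewrite big_ord_recl big_ord0 /= addr0 addnA hm ?inE ?eqxx ?orbT // !addn0.
  by case: (y < x)%N; rewrite !(expr0, subn0, subnn, mulr0n, add0r, addr0, mulr1n).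
(* By [hm], a gap filled with [m] contains exactly one descent: nothing changes if the gap was a
   descent, one is gained otherwise. *)
rewrite big_ord_recl /= addnA hm ?inE ?eqxx ?orbT //.
have hm' u v : u \in [:: z, y & t] -> v \in [:: z, y & t] -> ((m < u) + (v < m) = 1)%N.
  by rewrite !inE => hu hv; apply: hm; rewrite !inE; lia.
under eq_bigr => i _ do rewrite exprD.
rewrite -mulr_sumr IH //.
have := ndes_size z (rcons t y); rewrite size_rcons.
move: (ndes z _) => d dle.
case: (z < x)%N => /=; rewrite ?add1n ?add0n ?expr0 ?mul1r ?expr1.
  by rewrite subSS mulrS -addrA !exprS; ring.
by rewrite [in RHS]subSn // mulrS addrCA.
Qed.

Lemma extreme_in (le : rel nat) C : total le -> transitive le -> C != [::] ->
  exists2 m, m \in C & {in C, forall c, le c m}.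
Proof.
move=> tot tr; elim: C => // c C IH _; case: C IH => [|d C] IH.
  by exists c; rewrite ?mem_head // => x; rewrite inE => /eqP->; case/orP: (tot c c).
have [//|m mC hm] := IH; have [cm|mc] := orP (tot c m).
  by exists m; [rewrite inE mC orbT | move=> x; rewrite inE => /orP[/eqP->//|/hm]].
exists c; first exact: mem_head.
move=> x; rewrite inE => /orP[/eqP->|/hm]; first by case/orP: (tot c c).
by move/tr; apply.
Qed.

(* [m] can be the maximum of [p :: C], or its minimum when [p] is the maximum. *)
Lemma extreme_label p C : C != [::] -> p \notin C -> uniq C ->
  exists2 m, m \in C & forall u v, u \in p :: rem m C -> v \in p :: rem m C ->
    ((m < u) + (v < m) = 1)%N.
Proof.
move=> C0 pC uC.
have [M MC hM] := extreme_in leq_total leq_trans C0.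
have [m mC hm] := @extreme_in geq C (fun x y => leq_total y x)
  (fun y x z h1 h2 => leq_trans h2 h1) C0.
have [pM|Mp] := ltnP p M.
  exists M => // u v hu hv.
  have lt w : w \in p :: rem M C -> (w < M)%N.
    rewrite inE => /orP[/eqP->//|]; rewrite mem_rem_uniq // !inE => /andP[wM /hM].
    by rewrite leq_eqVlt (negPf wM).
  by rewrite (lt v) // ltnNge (ltnW (lt u hu)).
exists m => // u v hu hv.
have gt w : w \in p :: rem m C -> (m < w)%N.
  rewrite inE => /orP[/eqP->|].
    by rewrite ltn_neqAle (contraNneq _ pC) ?(leq_trans (hM m mC)) // => <-.
  rewrite mem_rem_uniq // !inE => /andP[wm /hm] /=.
  by rewrite leq_eqVlt eq_sym (negPf wm).
by rewrite (gt u) // ltnNge (ltnW (gt v hv)).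
Qed.

(** Reinserting an extreme label reproduces the recurrence [estep 1]. The result depends only on the
    number of labels, which makes the vertices of a tree independent. *)
Lemma sum_cyclic_descents p C : p \notin C -> uniq C ->
  \sum_(s <- permutations C) wt p s p = epoly R 1 (size C).
Proof.
have [n] := ubnP (size C); elim: n => // n IH in C *; rewrite ltnS => sC pC uC.
have [->|C0] := eqVneq C [::].
  by rewrite big_seq1 /= ltnn.
have [m mC hm] := extreme_label C0 pC uC.
have um : uniq (m :: rem m C) by rewrite -(perm_uniq (perm_to_rem mC)).
rewrite (perm_big _ (perm_permutations (perm_to_rem mC))) /= sum_perms_insert //.
have szC : size C = (size (rem m C)).+1.
  by rewrite size_rem // prednK //; case: (C) C0.
have [_ ur] := andP um.
rewrite szC /= -IH ?rem_uniq //; first last.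
- by apply: contra pC => /mem_rem.
- by rewrite -szC.
rewrite /estep linear_sum !mulr_sumr -big_split /= big_seq [RHS]big_seq.
apply: eq_bigr => s; rewrite mem_permutations => hs.
rewrite sum_insert; last first.
  move=> u v hu hv; apply: hm.
    by move: hu; rewrite !inE (perm_mem hs); case: eqP.
  by move: hv; rewrite !inE (perm_mem hs); case: eqP.
rewrite (perm_size hs).
have := ndes_size p (rcons s p); rewrite size_rcons (perm_size hs).
move: (ndes _ _) (size _) => d k dk; rewrite derivXn addn1.
rewrite -!(mulr_natr 'X^_) natrB //.
by case: d {dk} => [|d]; rewrite ?expr0 ?exprS ?mulr0n ?mulr0 /=; ring.
Qed.

End CyclicDescents.

(** * Labelled trees *)

Inductive btree := Leaf | Node of btree & btree.

Definition btree_eq_dec (t u : btree) : decidable (t = u).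
Proof. by rewrite /decidable; decide equality. Defined.

HB.instance Definition _ := hasDecEq.Build btree (compareP btree_eq_dec).

Fixpoint nnodes t := if t is Node l r then (nnodes l + nnodes r).+1 else 0%N.
Fixpoint spine t := if t is Node l r then (spine r).+1 else 0%N.

Lemma spine_nnodes t : (spine t <= nnodes t)%N.
Proof. by elim: t => //= l _ r IH; lia. Qed.

(** The fuel makes the recursion structural, as the sizes [i] and [m - i] of the two subtrees are
    not subterms of [m.+1]. *)
Fixpoint trees_upto fuel n : seq btree :=
  match fuel, n with
  | _, 0 => [:: Leaf]
  | 0, _ => [::]
  | f.+1, m.+1 =>
    flatten [seq [seq Node l r | l <- trees_upto f i, r <- trees_upto f (m - i)%N]
            | i <- iota 0 m.+1]
  end.

Lemma trees_uptoSS f m : trees_upto f.+1 m.+1 =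
  flatten [seq [seq Node l r | l <- trees_upto f i, r <- trees_upto f (m - i)%N]
          | i <- iota 0 m.+1].
Proof. by []. Qed.

Definition trees n := trees_upto n n.

Lemma trees_uptoE f n : (n <= f)%N -> trees_upto f n = trees n.
Proof.
have H : forall f g m, (m <= f)%N -> (m <= g)%N -> trees_upto f m = trees_upto g m.
  elim=> [|{}f IH] [|g] [|m] // hf hg.
  rewrite !trees_uptoSS; congr flatten; apply/eq_in_map => i; rewrite mem_iota => /andP[_ hi].
  by rewrite (IH g i) ?(IH g (m - i)%N) //; lia.
by move=> nf; apply: H.
Qed.

Lemma treesS m : trees m.+1
  = flatten [seq [seq Node l r | l <- trees i, r <- trees (m - i)%N] | i <- iota 0 m.+1].
Proof.
rewrite /trees trees_uptoSS; congr flatten; apply/eq_in_map => i; rewrite mem_iota => /andP[_ hi].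
by rewrite !trees_uptoE //; lia.
Qed.

Lemma mem_trees n t : (t \in trees n) = (nnodes t == n).
Proof.
elim: n {-2}n (leqnn n) t => [|N IH] [|n] // nN t; try by case: t.
rewrite treesS; apply/flatten_mapP/eqP => [[i]|].
  rewrite mem_iota => /andP[_ hi] /allpairsP[[l r] /= [hl hr ->]] /=.
  have [iN niN] : (i <= N)%N /\ (n - i <= N)%N by lia.
  by move: hl hr; rewrite !IH // => /eqP -> /eqP ->; lia.
case: t => [|l r] // [e]; exists (nnodes l); first by rewrite mem_iota; lia.
by apply/allpairsP; exists (l, r); split=> //=; rewrite IH; lia.
Qed.

Lemma trees_uniq n : uniq (trees n).
Proof.
elim: n {-2}n (leqnn n) => [|N IH] [|n] // nN.
rewrite treesS.
have -> : flatten [seq [seq Node l r | l <- trees i, r <- trees (n - i)%N] | i <- iota 0 n.+1]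
  = [seq Node p.1 p.2 | i <- iota 0 n.+1,
       p <- [seq (l, r) | l <- trees i, r <- trees (n - i)%N]].
  by congr flatten; apply: eq_map => i; rewrite map_allpairs.
apply: allpairs_uniq_dep; first exact: iota_uniq.
  move=> i; rewrite mem_iota => hi.
  by apply: allpairs_uniq; rewrite ?IH //; [lia | lia | move=> [? ?] [? ?]].
move=> _ _ /allpairsPdep[i [p [hi hp ->]]] /allpairsPdep[j [q [hj hq ->]]] /= [e1 e2].
case/allpairsP: hp => -[l r] /= [hl _ ep]; case/allpairsP: hq => -[l' r'] /= [hl' _ eq].
move: hl hl'; rewrite !mem_trees => /eqP hl /eqP hl'.
rewrite ep eq /= in e1 e2 *; rewrite e1 e2 -hl -hl' e1.
by [].
Qed.

(* [Node l r] is a plane forest in first-child/next-sibling form: [l] hangs below the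
   first edge, [r] is the rest.  Labels of [r] come before those of [l], so that the
   edges at the root get the first [spine t] labels. *)
Fixpoint word (t : btree) (s : seq nat) : seq nat :=
  if t is Node l r then
    if s is a :: s' then
      a :: word l (drop (nnodes r) s') ++ a :: word r (take (nnodes r) s')
    else [::]
  else [::].

Section TreeWeights.
Variable F : numFieldType.
Notation wt x s y := ('X^(ndes x (rcons s y)) : {poly F}).

(** [ehat F 1 j] is the mean of ['X^d] over the labellings of [j] edges below a vertex, [d] being
    the cyclic descents there. Here the root is left out; [tweight] includes it. *)
Fixpoint sweight t : {poly F} :=
  if t is Node l r then (sweight l * ehat F 1 (spine l)) * sweight r else 1.

Definition tweight t : {poly F} := sweight t * ehat F 1 (spine t).

Lemma wt_node x y a l r : wt x (a :: l ++ a :: r) y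
  = ('X^((a < x)%N) * wt a r y) * wt a l a.
Proof.
rewrite /= rcons_cat /= -cat_rcons ndes_cat last_rcons -!exprD; congr ('X^ _).
by rewrite addnAC addnA.
Qed.

Lemma ehat_fact k j : ehat F k j *+ j`! = epoly F k j.
Proof.
by rewrite /ehat -(mulr_natl (_ * _)) mulrA natr_polyCV ?mul1r // fact_gt0.
Qed.

(* By rotation invariance of cyclic descents, the words nested inside a letter
   contribute a factor independent of that letter. *)
Lemma sum_word_spine t M x y : uniq M -> size M = nnodes t ->
  \sum_(s <- permutations M) wt x (word t s) y
    = sweight t * \sum_(s <- permutations M) wt x (take (spine t) s) y.
Proof.
elim: t M x y => [|l IHl r IHr] M x y uM sM.
  by rewrite mul1r; apply: eq_bigr => s _; rewrite take0.
have M0 : (0 < size M)%N by rewrite sM.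
rewrite !sum_perms_cons // mulr_sumr big_seq [RHS]big_seq; apply: eq_bigr => a aM.
have ur : uniq (rem a M) by rewrite rem_uniq.
have sr : size (rem a M) = (nnodes r + nnodes l)%N by rewrite size_rem // sM /= addnC.
have nar : a \notin rem a M by rewrite mem_rem_uniqF.
under eq_bigr => s _ do rewrite [word _ _]/= wt_node.
(* The labels of [l] are averaged first: whatever set [C] they form, the word between the two
   letters [a] has mean [tweight l]. Then the induction hypothesis for [r] is applied to the
   prefix. *)
rewrite (sum_perms_suffix (fun s => 'X^((a < x)%N) * wt a (word r s) y)
   (h := fun s => wt a (word l s) a) (H := tweight l) ur sr); last first.
  move=> C uC sC szC; rewrite IHl //.
  rewrite (@sum_perms_prefix _ _ C (spine l) (fun s => wt a s a) (fun=> 1)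
     (ehat F 1 (spine l))) ?szC ?spine_nnodes //; last first.
    move=> D uD sD szD; rewrite sum_cyclic_descents ?szD //; last first.
      by apply: contra nar => /sD /sC.
    by rewrite sum_perms_const // szD -ehat_fact mulrnAr mulr1.
  by rewrite sum_perms_const // szC mulrA mulrnAr mulr1.
rewrite (@sum_perms_prefix _ _ (rem a M) (nnodes r)
   (fun s => 'X^((a < x)%N) * wt a (word r s) y)
   (fun s => 'X^((a < x)%N) * wt a (take (spine r) s) y) (sweight r)) //; first last.
- by move=> C uC sC szC; rewrite -mulr_sumr IHr // -mulr_sumr; ring.
- by rewrite sr leq_addr.
rewrite mulrA; congr (_ * _); apply: eq_bigr => s _.
by rewrite take_takel ?spine_nnodes //= exprD.
Qed.

Lemma sum_word t M p : uniq M -> size M = nnodes t -> p \notin M ->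
  \sum_(s <- permutations M) wt p (word t s) p = tweight t *+ (size M)`!.
Proof.
move=> uM sM pM; rewrite sum_word_spine //.
rewrite (@sum_perms_prefix _ _ M (spine t) (fun s => wt p s p) (fun=> 1)
   (ehat F 1 (spine t))) ?sM ?spine_nnodes //; last first.
  move=> D uD sD szD; rewrite sum_cyclic_descents ?szD //; last first.
    by apply: contra pM => /sD.
  by rewrite sum_perms_const // szD -ehat_fact mulrnAr mulr1.
by rewrite sum_perms_const // sM mulrA mulrnAr mulr1.
Qed.

(** [V m k] collects the trees with [k] edges at the root. Splitting off the first such edge
    multiplies by [z y], and the root vertex contributes [ehat F 1 k], so [y = A(t, z y)]. *)
Lemma sum_tweight n : n.+1%:R * (\sum_(t <- trees n) tweight t) = ehat F n.+1 n.
Proof.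
pose y m := \sum_(t <- trees m) tweight t.
pose V m k := \sum_(t <- trees m | spine t == k) sweight t.
apply: (@lagrange_inversion F y V).
- by rewrite /V big_cons big_nil /= addr0.
- by move=> k; rewrite /V big_cons big_nil.
- move=> m; rewrite /V big_seq_cond big1 // => t /andP[].
  by rewrite mem_trees; case: t.
- move=> m k; rewrite /V treesS big_flatten big_map -[iota 0 m.+1]/(index_iota 0 m.+1) big_mkord.
  apply: eq_bigr => i _; rewrite big_mkcond big_allpairs_dep /= /y mulr_suml.
  apply: eq_bigr => l _; rewrite mulr_sumr [RHS]big_mkcond /=.
  by apply: eq_bigr => r _; rewrite eqSS.
move=> m; rewrite /y /V.
under [RHS]eq_bigr => k _ do rewrite mulr_sumr big_mkcond.
rewrite exchange_big /=; apply: eq_big_seq => t; rewrite mem_trees => /eqP st.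
have lt : (spine t < m.+1)%N by rewrite ltnS -st spine_nnodes.
rewrite (bigD1 (Ordinal lt)) //= eqxx big1 ?addr0 /tweight 1?mulrC // => k.
by rewrite -val_eqE eq_sym /= => /negPf ->.
Qed.

End TreeWeights.

(** * Quasi-Stirling permutations *)

Definition noncrossing (w : seq nat) := forall a b, ~~ subseq [:: a; b; a; b] w.

Lemma noncrossing_sub u w : subseq u w -> noncrossing w -> noncrossing u.
Proof. by move=> uw nw a b; apply: contra (nw a b) => /subseq_trans; apply. Qed.

Lemma subseq_cons_catr (T : eqType) (x : T) s u v :
  x \notin u -> subseq (x :: s) (u ++ v) = subseq (x :: s) v.
Proof.
elim: u => //= y u IH; rewrite inE negb_or => /andP[/negPf xy /IH <-].
by rewrite xy.
Qed.

Lemma subseq_rcons_catl (T : eqType) (x : T) s u v :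
  x \notin v -> subseq (rcons s x) (u ++ v) = subseq (rcons s x) u.
Proof.
move=> xv; rewrite -subseq_rev rev_cat rev_rcons subseq_cons_catr ?mem_rev //.
by rewrite -rev_rcons subseq_rev.
Qed.

(** [u] and [v] have no common letter and do not contain [a], so a pattern [b c b c] with [b] other
    than [a] would lie inside one of them, and a pattern [a c a c] would need an [a] there. *)
Lemma noncrossing_node a u v : a \notin u -> a \notin v ->
  (forall x, x \in u -> x \notin v) -> noncrossing u -> noncrossing v ->
  noncrossing (a :: u ++ a :: v).
Proof.
move=> au av uv nu nv b c; apply/negP.
have notin (x : nat) s t : subseq s t -> x \notin t -> x \in s -> False.
  by move=> /mem_subseq h xt /h; rewrite (negPf xt).
rewrite [subseq _ _]/=; case: (eqVneq b a) => [-> | ba] h.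
  (* For [c = a] the pattern would need four letters [a], of which the word has two. *)
  have ca : c != a.
    apply/eqP => ca; rewrite ca in h.
    have := leq_count_subseq (pred1 a) h.
    by rewrite /= eqxx count_cat /= eqxx (count_memPn au) (count_memPn av).
  have [cu|cu] := boolP (c \in u).
    move: h; rewrite -[[:: c; a; c]]/(rcons [:: c; a] c) subseq_rcons_catl; last first.
      by rewrite inE negb_or ca uv.
    by move=> h; apply: (notin a _ _ h au); rewrite !inE eqxx orbT.
  move: h; rewrite subseq_cons_catr //= (negPf ca).
  by move=> h; apply: (notin a _ _ h av); rewrite !inE eqxx orbT.
have [bu|bu] := boolP (b \in u); last first.
  move: h; rewrite subseq_cons_catr //= (negPf ba).
  by rewrite (negPf (nv b c)).
have bav : b \notin a :: v by rewrite inE negb_or ba uv.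
have h1 : subseq (rcons [:: b; c] b) u.
  rewrite -(subseq_rcons_catl _ _ bav); apply: subseq_trans h.
  by rewrite /= !eqxx.
have cu : c \in u by apply: (mem_subseq h1); rewrite !inE eqxx orbT.
have ca : c != a by apply: contraNneq au => <-.
move: h; rewrite -[[:: b; c; b; c]]/(rcons [:: b; c; b] c) subseq_rcons_catl.
  by rewrite (negPf (nu b c)).
by rewrite inE negb_or ca uv.
Qed.

Lemma count_word t s (x : nat) : uniq s -> size s = nnodes t ->
  count_mem x (word t s) = (x \in s).*2.
Proof.
elim: t s => [|l IHl r IHr] [|a s] //= /andP[nas us] [ss].
have [ut ud] : uniq (take (nnodes r) s) /\ uniq (drop (nnodes r) s).
  by rewrite take_uniq ?drop_uniq.
rewrite count_cat /= IHl ?IHr ?size_drop ?ss ?addnK //; last first.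
  by rewrite size_takel // ss leq_addl.
have e : ((x \in s) = (x \in take (nnodes r) s) + (x \in drop (nnodes r) s) :> nat)%N.
  move: us; rewrite -{1 2}(cat_take_drop (nnodes r) s) cat_uniq mem_cat => /and3P[_ /hasPn h _].
  case: (boolP (x \in take _ _)) => //= xt.
  by case: (boolP (x \in drop _ _)) => // /h /=; rewrite xt.
rewrite inE [x == a]eq_sym; case: eqVneq => [ea|_] /=; last first.
  by rewrite !add0n e doubleD addnC.
move: nas; rewrite ea => /negPf nas; move: e; rewrite nas.
by do 2 case: (x \in _).
Qed.

Lemma mem_word t s x : uniq s -> size s = nnodes t -> (x \in word t s) = (x \in s).
Proof. by move=> us ss; rewrite -has_pred1 has_count count_word //; case: (x \in s). Qed.

Lemma size_word t s : size s = nnodes t -> size (word t s) = (2 * nnodes t)%N.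
Proof.
elim: t s => [|l IHl r IHr] [|a s] //= [ss].
rewrite size_cat /= IHl ?IHr; last 2 first.
- by rewrite size_takel // ss leq_addl.
- by rewrite size_drop ss addnK.
lia.
Qed.

Lemma word_split l r (a : nat) s : uniq (a :: s) -> size s = (nnodes l + nnodes r)%N ->
  [/\ uniq (take (nnodes r) s), uniq (drop (nnodes r) s),
      size (take (nnodes r) s) = nnodes r, size (drop (nnodes r) s) = nnodes l
    & [/\ a \notin take (nnodes r) s, a \notin drop (nnodes r) s
        & forall x, x \in drop (nnodes r) s -> x \notin take (nnodes r) s]].
Proof.
move=> /= /andP[nas us] ss.
rewrite take_uniq ?drop_uniq // size_takel ?ss ?leq_addl // size_drop ss addnK.
split=> //; split.
- by apply: contra nas => /mem_take.
- by apply: contra nas => /mem_drop.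
- move: us; rewrite -{1}(cat_take_drop (nnodes r) s) cat_uniq => /and3P[_ /hasPn h _].
  by move=> x /h.
Qed.

Lemma noncrossing_word t s : uniq s -> size s = nnodes t -> noncrossing (word t s).
Proof.
elim: t s => [|l IHl r IHr] [|a s] //= us [ss].
have [ut ud st sd [h1 h2 h3]] := word_split us ss.
apply: noncrossing_node; rewrite ?mem_word //; [|exact: IHl|exact: IHr].
by move=> x; rewrite !mem_word //; exact: h3.
Qed.

Lemma cat_cons_inj (T : eqType) (x : T) u v u' v' : x \notin u -> x \notin u' ->
  u ++ x :: v = u' ++ x :: v' -> u = u' /\ v = v'.
Proof.
elim: u u' => [|y u IH] [|y' u'] //=.
- by move=> _ _ [->].
- by rewrite inE negb_or => _ /andP[/negPf h _] [e _]; rewrite e eqxx in h.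
- by rewrite inE negb_or => /andP[/negPf h _] _ [e _]; rewrite e eqxx in h.
rewrite !inE !negb_or => /andP[_ h] /andP[_ h'] [-> /IH].
by case=> // -> ->.
Qed.

(** The second occurrence of the first letter separates the words of the two subtrees. *)
Lemma word_inj t s t' s' : uniq s -> size s = nnodes t -> uniq s' -> size s' = nnodes t' ->
  word t s = word t' s' -> t = t' /\ s = s'.
Proof.
elim: t s t' s' => [|l IHl r IHr] [|a s] [|l' r'] [|a' s'] //= us [ss] us' [ss'] [ea e].
rewrite -ea in us' e *.
have [ut ud st sd [h1 h2 h3]] := word_split us ss.
have [ut' ud' st' sd' [h1' h2' h3']] := word_split us' ss'.
have [||el er] := cat_cons_inj _ _ e; rewrite ?mem_word //.
have [-> ed] := IHl _ _ _ ud sd ud' sd' el.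
have [er' et] := IHr _ _ _ ut st ut' st' er.
split; first by rewrite er'.
by congr (_ :: _); rewrite -(cat_take_drop (nnodes r) s) et ed cat_take_drop.
Qed.

(** Write the word as [a u a v]. A letter common to [u] and [v] would cross [a], so both letters of
    each pair lie in the same block and the induction applies to [u] and [v]. *)
Lemma word_surj w : {in w, forall x, count_mem x w = 2%N} -> noncrossing w ->
  exists t s, [/\ uniq s, size s = nnodes t & w = word t s].
Proof.
have [n] := ubnP (size w); elim: n => // n IH in w *; rewrite ltnS.
case: w => [|a w] /= sw cw nw; first by exists Leaf, [::].
have := cw a (mem_head _ _); rewrite /= eqxx /= add1n => -[ca].
have aw : a \in w by rewrite -has_pred1 has_count ca.
case: (path.splitPr aw) sw cw nw ca => u v sw cw nw ca {aw}.
move: ca; rewrite count_cat /= eqxx addnCA add1n => -[/eqP].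
rewrite addn_eq0 => /andP[/eqP cu0 /eqP cv0].
have au : a \notin u by apply/count_memPn.
have av : a \notin v by apply/count_memPn.
have cE x : x != a ->
    ((a == x) + count_mem x (u ++ a :: v) = count_mem x u + count_mem x v)%N.
  by move=> xa; rewrite count_cat /= eq_sym (negPf xa).
have uv x : x \in u -> x \notin v.
  move=> xu; apply/negP => xv; have := nw a x; rewrite /= eqxx.
  rewrite -[[:: x; a; x]]/([:: x] ++ [:: a; x]) cat_subseq // ?sub1seq //=.
  by rewrite eqxx sub1seq.
have ne (x : nat) (s : seq nat) : a \notin s -> x \in s -> x != a by move=> h xs; apply: contraNneq h => <-.
have [|||t1 [s1 [us1 ss1 e1]]] := IH u.
- by move: sw; rewrite size_cat /=; lia.
- move=> x xu; have xa := ne _ _ au xu.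
  have := cw x; rewrite cE // (count_memPn (uv _ xu)) addn0; apply.
  by rewrite inE mem_cat xu orbT.
- apply: noncrossing_sub nw; apply: subseq_trans (subseq_cons _ _).
  exact: prefix_subseq.
have [|||t2 [s2 [us2 ss2 e2]]] := IH v.
- by move: sw; rewrite size_cat /=; lia.
- move=> x xv; have xa := ne _ _ av xv.
  have xu : x \notin u by apply/negP => /uv; rewrite xv.
  have := cw x; rewrite cE // (count_memPn xu) add0n; apply.
  by rewrite inE mem_cat inE xv !orbT.
- apply: noncrossing_sub nw; apply: subseq_trans (subseq_cons _ _).
  by apply: subseq_trans (suffix_subseq _ _); exact: subseq_cons.
exists (Node t1 t2), (a :: s2 ++ s1); split.
- rewrite /= mem_cat negb_or -(mem_word _ us2 ss2) -(mem_word _ us1 ss1) -e1 -e2 au av /=.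
  rewrite cat_uniq us2 us1 andbT; apply/hasPn => x; rewrite /= -(mem_word _ us1 ss1).
  by rewrite -(mem_word _ us2 ss2) -e1 -e2; exact: uv.
- by rewrite /= size_cat ss1 ss2 addnC.
- by rewrite /= take_size_cat // drop_size_cat // -e1 -e2.
Qed.

Section Words.
Variables (n : nat).
Implicit Type f : {ffun 'I_(2 * n) -> 'I_n}.

(** The shift to the letters [1, ..., n] frees [0] as a boundary letter below all of them. *)
Definition ffun_word f : seq nat := [seq (f i).+1 | i <- enum 'I_(2 * n)].

Lemma ffun_word_inj : injective ffun_word.
Proof.
move=> f g /eq_in_map e; apply/ffunP => i; apply: val_inj.
by have := e i; rewrite mem_enum => /(_ isT) [].
Qed.

Lemma subseq_enum_ord N (s : seq 'I_N) :
  subseq s (enum 'I_N) = path.sorted ltn (map val s).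
Proof.
have se : path.sorted ltn (map val (enum 'I_N)) by rewrite val_enum_ord iota_ltn_sorted.
apply/idP/idP => [h | h].
  exact: (subseq_sorted ltn_trans (map_subseq val h) se).
apply/(subseq_uniqP (enum_uniq _)); apply: (inj_map val_inj).
apply: (irr_sorted_eq ltn_trans ltnn) => //.
  by apply: (subseq_sorted ltn_trans _ se); apply: map_subseq; exact: filter_subseq.
by apply: eq_mem_map => x; rewrite mem_filter mem_enum andbT.
Qed.

Lemma count_ffun_word f (v : 'I_n) :
  count_mem v.+1 (ffun_word f) = #|[set i | f i == v]|.
Proof.
rewrite /ffun_word count_map -sum1_card -sum1_count big_enum_cond /=.
by apply: eq_bigl => i; rewrite inE eqSS.
Qed.

Lemma quasiStirlingP f :
  reflect ((forall v : 'I_n, count_mem v.+1 (ffun_word f) = 2%N)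
            /\ noncrossing (ffun_word f))
          (quasiStirling f).
Proof.
apply: (iffP andP) => -[h1 h2]; split.
- by move=> v; rewrite count_ffun_word; apply/eqP; exact: (forallP h1).
- move=> a b; apply: contra h2 => /subseqP[m sm]; rewrite /ffun_word -map_mask.
  have := mask_subseq m (enum 'I_(2 * n)); rewrite subseq_enum_ord.
  case: (mask _ _) => [|i [|j [|k [|l []]]]] //= /and4P[ij jk kl _] [ei ej ek el].
  apply/existsP; exists i; apply/existsP; exists j; apply/existsP; exists k.
  apply/existsP; exists l; rewrite ij jk kl /=.
  by rewrite -!val_eqE /=; apply/andP; split; apply/eqP; lia.
- by apply/forallP => v; rewrite -count_ffun_word h1.
- apply/existsP => -[i /existsP[j /existsP[k /existsP[l]]]].
  case/and5P => ij jk kl /eqP fik /eqP fjl.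
  have := h2 (f i).+1 (f j).+1; rewrite {2}fik {2}fjl.
  rewrite (map_subseq (fun i => (f i).+1) (_ : subseq [:: i; j; k; l] _)) //.
  by rewrite subseq_enum_ord /= ij jk kl.
Qed.

(** The final [0] makes the last position a descent, as the definition of [is_descent] requires, and
    the initial [0] creates none. *)
Lemma des_ffun_word f : (0 < n)%N -> des f = ndes 0 (rcons (ffun_word f) 0).
Proof.
move=> n0.
have ndesE x s : ndes x s = (\sum_(i < size s) (nth 0 s i < nth 0 (x :: s) i))%N.
  elim: s x => [|y s IH] x; first by rewrite big_ord0.
  by rewrite /= big_ord_recl /= IH.
rewrite ndesE size_rcons size_map size_enum_ord big_ord_recl /=.
have nthw (i : 'I_(2 * n)) : nth 0%N (ffun_word f) i = (f i).+1.
  rewrite (nth_map i) ?size_enum_ord //; congr (val (f _)).+1.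
  by apply: val_inj; rewrite /= nth_enum_ord.
have szw : size (ffun_word f) = (2 * n)%N by rewrite size_map size_enum_ord.
rewrite add0n /des -sum1_card big_mkcond /=.
apply: eq_bigr => i _; rewrite inE /bump /= add1n !nth_rcons szw ltn_ord nthw.
rewrite /is_descent.
have [lt|ge] := ltnP i.+1 (2 * n).
  rewrite (ltn_eqF lt) /= -[i.+1]/(val (Ordinal lt)) nthw ltnS.
  have -> : [exists j : 'I_(2 * n), (val j == i.+1) && (f j < f i)%N]
      = (f (Ordinal lt) < f i)%N.
    apply/existsP/idP => [[j /andP[/eqP ej h]] | h]; last by exists (Ordinal lt); rewrite eqxx.
    by rewrite (_ : Ordinal lt = j) //; apply: val_inj.
  by case: (_ < _)%N.
have -> : i.+1 = (2 * n)%N by apply/eqP; rewrite eqn_leq ge ltn_ord.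
by rewrite eqxx.
Qed.

(** Both lists are free of repetitions, by injectivity of [ffun_word] and [word], and have the same
    elements, by [word_surj] and [noncrossing_word]. *)
Lemma perm_ffun_words : (0 < n)%N ->
  perm_eq [seq ffun_word f | f <- enum (@quasiStirling n)]
          [seq word t s | t <- trees n, s <- permutations (iota 1 n)].
Proof.
move=> n0; apply: uniq_perm.
- by rewrite map_inj_uniq ?enum_uniq //; exact: ffun_word_inj.
- apply: allpairs_uniq; rewrite ?trees_uniq ?permutations_uniq //.
  move=> _ _ /allpairsP[[t s] /= [ht hs ->]] /allpairsP[[t' s'] /= [ht' hs' ->]] /= e.
  move: ht ht' hs hs'; rewrite !mem_trees !mem_permutations => /eqP tn /eqP tn' ps ps'.
  have [||||-> -> //] := word_inj _ _ _ _ e;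
    by rewrite ?(perm_uniq ps) ?(perm_uniq ps') ?iota_uniq // ?(perm_size ps)
               ?(perm_size ps') size_iota.
move=> w; apply/mapP/allpairsP => [[f] | [[t s] /= [ht hs ->]]].
  rewrite mem_enum => /quasiStirlingP[c2 nc ->].
  have memw x : (x \in ffun_word f) = (x \in iota 1 n).
    rewrite mem_iota; apply/mapP/idP => [[i _ ->] | /andP[x1 xn]].
      by rewrite add1n ltnS /= ltnS; exact: ltn_ord.
    have xn' : (x.-1 < n)%N by lia.
    have := c2 (Ordinal xn'); rewrite /= prednK // => cx.
    have : x \in ffun_word f by rewrite -has_pred1 has_count cx.
    by case/mapP => i; exists i.
  have [|t [s [us ss e]]] := word_surj _ nc.
    move=> x; rewrite memw mem_iota => /andP[x1 xn].
    have xn' : (x.-1 < n)%N by lia.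
    by have := c2 (Ordinal xn'); rewrite /= prednK.
  have ps : perm_eq s (iota 1 n).
    apply: uniq_perm; rewrite ?iota_uniq // => x.
    by rewrite -(mem_word _ us ss) -e memw.
  exists (t, s); rewrite /= mem_trees mem_permutations ps -ss (perm_size ps) size_iota.
  by rewrite eqxx.
move: ht hs; rewrite mem_trees mem_permutations => /eqP tn ps.
have us : uniq s by rewrite (perm_uniq ps) iota_uniq.
have ss : size s = nnodes t by rewrite (perm_size ps) size_iota.
have sw := size_word ss; rewrite tn in sw.
have wn (i : 'I_(2 * n)) : (0 < nth 0 (word t s) i <= n)%N.
  have : nth 0%N (word t s) i \in word t s by rewrite mem_nth // sw.
  by rewrite mem_word // (perm_mem ps) mem_iota add1n ltnS.
have wn' (i : 'I_(2 * n)) : ((nth 0 (word t s) i).-1 < n)%N by have := wn i; lia.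
pose f : {ffun 'I_(2 * n) -> 'I_n} := [ffun i => Ordinal (wn' i)].
have e : word t s = ffun_word f.
  apply: (@eq_from_nth _ 0%N); first by rewrite sw size_map size_enum_ord.
  move=> i; rewrite sw => hi; rewrite (nth_map (Ordinal hi)) ?size_enum_ord //.
  have -> : nth (Ordinal hi) (enum 'I_(2 * n)) i = Ordinal hi.
    by apply: val_inj; rewrite /= nth_enum_ord.
  by rewrite ffunE /= prednK //; have /andP[] := wn (Ordinal hi).
exists f => //; rewrite mem_enum; apply/quasiStirlingP; rewrite -e; split.
  move=> v; rewrite count_word // (perm_mem ps) mem_iota /= add1n ltnS ltn_ord.
  by [].
exact: noncrossing_word.
Qed.

Lemma Qbarpoly_eulp (F : numFieldType) : (0 < n)%N ->
  Qbarpoly F n = 'X * eulp F 1 n.+1 n.-1.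
Proof.
move=> n0.
have QE : Qbarpoly F n = \sum_(t <- trees n) tweight F t *+ n`!.
  rewrite /Qbarpoly.
  transitivity (\sum_(w <- [seq ffun_word f | f <- enum (@quasiStirling n)])
     'X^(ndes 0 (rcons w 0)) : {poly F}).
    rewrite big_map big_enum /=; apply: eq_bigr => f _; rewrite des_ffun_word //.
  rewrite (perm_big _ (perm_ffun_words n0)) /= big_allpairs_dep.
  apply: eq_big_seq => t; rewrite mem_trees => /eqP tn.
  rewrite sum_word ?iota_uniq ?size_iota //.
  by rewrite mem_iota.
have h := sum_tweight F n.
(* The factor [n + 1] appears on the left through Lagrange inversion and on the right through
   [epoly_eulp]; it then cancels. *)
have : n.+1%:R * Qbarpoly F n = n.+1%:R * ('X * eulp F 1 n.+1 n.-1).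
  rewrite QE sumrMnl mulrnAr h ehat_fact mulrA.
  by case: (n) n0 => // k _; rewrite epoly_eulp.
apply: mulfI; rewrite -polyC_natr polyC_eq0 pnatr_eq0.
by [].
Qed.

End Words.

Theorem theorem3p2 (n r : nat) :
  (1 <= r)%N -> (r <= n)%N ->
  [/\ real_distinct_nonpos_roots (Apoly algC n r),
      real_distinct_nonpos_roots (Jpoly algC n r)
    & real_distinct_nonpos_roots (Qbarpoly algC n)].
Proof.
move=> r0 rn; have n0 : (0 < n)%N by exact: leq_trans rn.
have f0 : (r`!)%:R != 0 :> algC by rewrite pnatr_eq0 -lt0n fact_gt0.
split.
- rewrite -(subnKC rn) Apoly_eulp -[eulp _ _ _ _]mul1r -(expr0 'X).
  exact: eulp_real_roots.
- have [K K0] := Jpoly_eulp algC r (n - r); rewrite subnKC // => e.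
  have K0' : K%:R != 0 :> algC by rewrite pnatr_eq0 -lt0n.
  have -> : Jpoly algC n r = (K%:R^-1 * (r`!)%:R) *: ('X^0 * eulp algC 1 r (n - r)).
    by rewrite expr0 mul1r -scalerA -e -scaler_nat scalerA mulVf // scale1r.
  by apply: eulp_real_roots => //; rewrite mulf_neq0 ?invr_eq0.
- have -> : Qbarpoly algC n = 1 *: ('X^1 * eulp algC 1 n.+1 n.-1).
    by rewrite Qbarpoly_eulp // scale1r.
  by apply: eulp_real_roots => //; exact: oner_neq0.
Qed.
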